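(* Let $\Gamma$ and $\Gamma'$ be transmission regular digraphs of orders $n$ and $n'$ with transmissions $t$ and $t'$, respectively, and let $\operatorname{spec}(\mathcal{D}(\Gamma))=\{t,\partial_2,\dots,\partial_n\}$ and $\operatorname{spec}(\mathcal{D}(\Gamma'))=\{t',\partial'_2,\dots,\partial'_{n'}\}$. Then $$\operatorname{spec}(\mathcal{D}(\Gamma\,\Box\,\Gamma'))=\{nt'+n't,\ n'\partial_2,\dots,n'\partial_n,\ n\partial'_2,\dots,n\partial'_{n'},\ 0^{((n-1)(n'-1))}\}.$$
   Context: A digraph $\Gamma$ has a finite vertex set $V(\Gamma)=\{v_1,\dots,v_n\}$ and a set $E(\Gamma)$ of ordered pairs of distinct vertices (arcs); $n$ is its order. A digraph of order at least two is strongly connected if for every pair of vertices $u,v$ there is a dipath from $u$ to $v$. For strongly connected $\Gamma$, $d(u,v)$ is the length of a shortest dipath from $u$ to $v$, the distance matrix $\mathcal{D}(\Gamma)$ has $(i,j)$ entry $d(v_i,v_j)$, and the transmission of $v_i$ is $\sum_j d(v_i,v_j)$. A strongly connected digraph is transmission regular with transmission $t$ ($t$-transmission regular) if every vertex has transmission $t$. The Cartesian product $\Gamma\,\Box\,\Gamma'$ has vertex set $V(\Gamma)\times V(\Gamma')$ and an arc from $(x,x')$ to $(y,y')$ iff ($x'=y'$ and $(x,y)\in E(\Gamma)$) or ($x=y$ and $(x',y')\in E(\Gamma')$). $\operatorname{spec}(A)$ is the multiset of complex eigenvalues of $A$ with algebraic multiplicity; $x^{(m)}$ means $x$ is listed $m$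 times. *)

(* Defs.v *)
From HB Require Import structures.
From mathcomp Require Import all_boot all_order all_algebra.
From mathcomp Require Import reals complex.

Set Implicit Arguments.
Unset Strict Implicit.
Unset Printing Implicit Defensive.

Import GRing.Theory.
Local Open Scope ring_scope.

Record digraph := Digraph {
  vertex :> finType;
  arc : rel vertex;
  arc_irrefl : irreflexive arc
}.

(* [p] lists the vertices after [u], so [size p] is the length of the dipath. *)
Definition dipath (G : digraph) (u v : G) (p : seq G) : bool :=
  [&& path (@arc G) u p, last u p == v & uniq (u :: p)].

Definition strongly_connected (G : digraph) : Prop :=
  (1 < #|G|)%N /\ forall u v : G, exists p : seq G, dipath u v p.

(* A dipath has fewer than #|G| arcs, so the search is exhaustive;             *)
(* the value is #|G| when there is no dipath from u to v.                      *)
Definition dist (G : digraph) (u v : G) : nat :=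
  find (fun k => [exists p : k.-tuple G, dipath u v p]) (iota 0 #|G|).

Definition transmission (G : digraph) (u : G) : nat :=
  (\sum_(v : G) dist u v)%N.

Definition transmission_regular (G : digraph) (t : nat) : Prop :=
  strongly_connected G /\ forall u : G, transmission u = t.

Section CartesianProduct.
Variables G H : digraph.

Definition cart_arc : rel (G * H) := fun x y =>
  ((x.2 == y.2) && arc x.1 y.1) || ((x.1 == y.1) && arc x.2 y.2).

Lemma cart_arc_irrefl : irreflexive cart_arc.
Proof. by move=> x; rewrite /cart_arc !arc_irrefl !andbF. Qed.

Definition cart_prod : digraph := Digraph cart_arc_irrefl.
End CartesianProduct.

Definition distance_matrix (R : nzSemiRingType) (G : digraph) : 'M[R]_#|G| :=
  \matrix_(i, j) (dist (enum_val i) (enum_val j))%:R.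

(* The eigenvalues with algebraic multiplicity, as a list whose order is       *)
(* immaterial: spectra are to be compared with [perm_eq]; see [count_spec].    *)
Definition spec (C : closedFieldType) (n : nat) (A : 'M[C]_n) : seq C :=
  sval (closed_field_poly_normal (char_poly A)).

Lemma char_poly_spec (C : closedFieldType) (n : nat) (A : 'M[C]_n) :
  char_poly A = \prod_(x <- spec A) ('X - x%:P).
Proof.
rewrite /spec; case: closed_field_poly_normal => r /= {1}->.
by rewrite (monicP (char_poly_monic A)) scale1r.
Qed.

Lemma count_spec (C : closedFieldType) (n : nat) (A : 'M[C]_n) (x : C) :
  count_mem x (spec A) = mup x (char_poly A).
Proof. by rewrite char_poly_spec mu_prod_XsubC. Qed.

Lemma size_dipath (G : digraph) (u v : G) (p : seq G) :
  dipath u v p -> (size p < #|G|)%N.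
Proof.
case/and3P=> _ _ U; have := max_card (mem (u :: p)).
by rewrite (card_uniqP U).
Qed.

Lemma dist_dipath (G : digraph) (u v : G) : strongly_connected G ->
  exists2 p, dipath u v p & size p = dist u v.
Proof.
case=> _ /(_ u v)[p up]; have Hp := size_dipath up.
set a := fun k => [exists p : k.-tuple G, dipath u v p].
have Ha : has a (iota 0 #|G|).
  apply/hasP; exists (size p); first by rewrite mem_iota.
  by apply/existsP; exists (in_tuple p).
have := nth_find 0%N Ha; rewrite nth_iota; last by move: Ha; rewrite has_find size_iota.
by case/existsP=> q uq; exists q; rewrite ?size_tuple.
Qed.

Lemma dist_le_dipath (G : digraph) (u v : G) (p : seq G) :
  dipath u v p -> (dist u v <= size p)%N.
Proof.
move=> up; have Hp := size_dipath up.
rewrite leqNgt; apply/negP => /(before_find 0%N).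
rewrite nth_iota // add0n => /existsP; case.
by exists (in_tuple p).
Qed.

(* Main.v *)
Require Import Defs.
From mathcomp Require Import all_boot all_order all_algebra.
From mathcomp Require Import reals complex.
From mathcomp Require Import ring.

Import GRing.Theory.
Local Open Scope ring_scope.

(** Write D, D' for the two distance matrices, of orders n and n', and 1, 1' for
    the all-ones columns.  A walk in the Cartesian product moves one coordinate
    at a time, so distances add ([dist_cart_prod]) and the distance matrix M of
    the product has entries D x y + D' x' y'.  Each summand factors through a
    space of dimension n or n': M is the row block [dist_left], [dist_right],
    which records the distances in each factor, times the column block
    [fiber_left], [fiber_right], which records the fibers of the two projections
    ([distance_matrix_cart_prod]).

    Exchanging the two factors of a product changes its characteristic
    polynomial only by a power of X ([char_poly_mulmxC]), so it is enough to
    treat the exchanged product, of order n + n' ([fiber_dist_block]):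
<<
      N = |  n' D           1 (1'^T D') |
          |  1' (1^T D)     n D'        |
>>
    Its off-diagonal blocks have rank one, with columns proportional to 1 and
    1', and transmission regularity says that n' D 1 = n' t 1 and
    n D' 1' = n t' 1'.  Hence span(1, 1') is stable under N, modulo this span N
    agrees with diag(n' D, n D'), and on it N acts as
<<
      | n' t    n' t' |
      | n t     n t'  |
>>
    which has eigenvalues n t' + n' t and 0: these replace the eigenvalues n' t
    and n t' of the diagonal blocks ([char_poly_eigenvector_block]).  The matrix
    D need not be normal, nor 1^T a left eigenvector of it, which is why the
    argument compares characteristic polynomials and uses no eigenbasis. *)

(** * Distances in a Cartesian product *)

(** The distance is defined by dipaths, which have no repeated vertex; walks are
    easier to concatenate and to project, and removing loops from a walk only
    shortens it. *)
Lemma dist_le_walk (G : digraph) (u : G) (p : seq G) :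
  path (@Defs.arc G) u p -> (dist u (last u p) <= size p)%N.
Proof.
move=> up; case: (shortenP up) => q uq Uq sqp.
apply: leq_trans (uniq_leq_size (subseq_uniq _ Uq) sqp); last exact: subseq_cons.
by apply: dist_le_dipath; rewrite /dipath uq eqxx.
Qed.

Lemma strongly_connected_walks (G : digraph) :
    (1 < #|G|)%N ->
    (forall u v : G, exists2 p, path (@Defs.arc G) u p & last u p = v) ->
  strongly_connected G.
Proof.
move=> G1 walks; split=> // u v; have [p up <-] := walks u v.
by case: (shortenP up) => q uq Uq _; exists q; rewrite /dipath uq eqxx.
Qed.

Lemma distxx (G : digraph) (u : G) : dist u u = 0%N.
Proof. by apply/eqP; rewrite -leqn0 (@dist_le_walk _ u [::]). Qed.

Lemma dist_arc (G : digraph) (u v w : G) :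
  strongly_connected G -> Defs.arc u v -> (dist u w <= (dist v w).+1)%N.
Proof.
move=> scG uv; have [p /and3P[vp /eqP <- _] <-] := dist_dipath v w scG.
by apply: (@dist_le_walk _ u (v :: p)); rewrite /= uv.
Qed.

(** First move the left coordinate, then the right one. *)
Lemma cart_walk (G H : digraph) (x y : G) (x' y' : H) :
    strongly_connected G -> strongly_connected H ->
  exists2 p : seq (cart_prod G H),
    path (@Defs.arc (cart_prod G H)) (x, x') p /\ last (x, x') p = (y, y')
    & size p = (dist x y + dist x' y')%N.
Proof.
move=> scG scH.
have [p /and3P[xp /eqP Lp _] <-] := dist_dipath x y scG.
have [q /and3P[xq /eqP Lq _] <-] := dist_dipath x' y' scH.
exists ([seq ((z, x') : cart_prod G H) | z <- p] ++ [seq (y, z) | z <- q]).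
  split; last by rewrite last_cat !last_map Lp last_map Lq.
  rewrite cat_path last_map Lp !path_map; apply/andP; split.
    by apply: sub_path xp => a b ab; rewrite /= /cart_arc /= eqxx ab.
  by apply: sub_path xq => a b ab; rewrite /= /cart_arc /= eqxx ab orbT.
by rewrite size_cat !size_map.
Qed.

(** Each arc of the product moves a single coordinate, along an arc of its
    factor, so it decreases the sum of the two coordinate distances to the end
    point by at most one. *)
Lemma cart_walk_size (G H : digraph) (x y : cart_prod G H) p :
    strongly_connected G -> strongly_connected H ->
    path (@Defs.arc (cart_prod G H)) x p -> last x p = y ->
  (dist x.1 y.1 + dist x.2 y.2 <= size p)%N.
Proof.
move=> scG scH; elim: p x => [|z p IHp] x /=.
  by move=> _ <-; rewrite !distxx.
case/andP=> xz zp Ly; apply: (@leq_trans (dist z.1 y.1 + dist z.2 y.2).+1).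
  case/orP: xz => /andP[/eqP -> xz].
    by rewrite -addSn leq_add2r dist_arc.
  by rewrite -addnS leq_add2l dist_arc.
exact: IHp.
Qed.

Lemma dist_cart_prod (G H : digraph) (x y : cart_prod G H) :
    strongly_connected G -> strongly_connected H ->
  dist x y = (dist x.1 y.1 + dist x.2 y.2)%N.
Proof.
move=> scG scH.
have sc : strongly_connected (cart_prod G H).
  apply: strongly_connected_walks => [|[u u'] [v v']].
    by rewrite card_prod (ltn_mul scG.1 scH.1).
  by have [p [? ?] _] := cart_walk _ _ u v u' v' scG scH; exists p.
apply/eqP; rewrite eqn_leq; apply/andP; split.
  case: x y => [x x'] [y y'] /=.
  have [p [xp Lp] <-] := cart_walk _ _ x y x' y' scG scH.
  by rewrite -Lp dist_le_walk.
have [p /and3P[xp /eqP Lp _] <-] := dist_dipath x y sc.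
exact: cart_walk_size.
Qed.

(** * Characteristic polynomials *)

(** Sylvester's determinant identity: both sides are obtained from
    [block_mx z%:M A B 1%:M], by clearing B, respectively A, with a triangular
    factor. *)
Lemma det_scalar_sub_mulmxC (R : comNzRingType) (m n : nat) (z : R)
    (A : 'M[R]_(m, n)) (B : 'M[R]_(n, m)) :
  z ^+ n * \det (z%:M - A *m B) = z ^+ m * \det (z%:M - B *m A).
Proof.
pose K := block_mx z%:M A B 1%:M.
have KB : \det K = \det (z%:M - A *m B).
  rewrite -[LHS]mulr1 -[X in _ * X](det1 R (m + n)).
  have <- : \det (block_mx 1%:M 0 (- B) 1%:M) = \det (1%:M : 'M[R]_(m + n)).
    by rewrite det_lblock !det1 mul1r.
  rewrite -det_mulmx mulmx_block !mulmx0 !mulmx1 !mul1mx mulmxN.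
  by rewrite subrr !add0r det_ublock det1 mulr1.
have KA : \det K * z ^+ n = z ^+ m * \det (z%:M - B *m A).
  have <- : \det (block_mx (1%:M : 'M[R]_m) (- A) 0 z%:M) = z ^+ n.
    by rewrite det_ublock det1 mul1r det_scalar.
  rewrite -det_mulmx mulmx_block !mulmx0 !mulmx1 !mul1mx !mulmxN.
  rewrite mul_scalar_mx mul_mx_scalar addNr !addr0 det_lblock det_scalar.
  by rewrite addrC.
by rewrite -KA KB mulrC.
Qed.

Lemma char_poly_mulmxC (R : comNzRingType) (m n : nat)
    (A : 'M[R]_(m, n)) (B : 'M[R]_(n, m)) :
  'X^n * char_poly (A *m B) = 'X^m * char_poly (B *m A).
Proof.
by rewrite /char_poly /char_poly_mx !map_mxM det_scalar_sub_mulmxC.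
Qed.

(** A Schur complement computation, made free of divisions: A acts as a on
    v and B as b on w, and multiplying by powers of a and b, cancelled at the
    end, replaces inverting A and B.  This matters because the lemma is applied
    to characteristic matrices, over a ring of polynomials, where a and b are
    linear factors. *)
Lemma det_eigenvector_block (R : idomainType) (m n : nat) (a b : R)
    (A : 'M[R]_m) (B : 'M[R]_n) (v : 'cV[R]_m) (w : 'cV[R]_n)
    (s : 'rV[R]_m) (r : 'rV[R]_n) :
  a != 0 -> b != 0 -> A *m v = a *: v -> B *m w = b *: w ->
  \det (block_mx A (- (v *m r)) (- (w *m s)) B) * (a * b)
    = \det A * \det B * (a * b - (s *m v) 0 0 * (r *m w) 0 0).
Proof.
move=> a0 b0 Av Bw; set K := block_mx _ _ _ _; set c := (s *m v) 0 0.
(* Clearing the upper right block leaves a rank-one update of a *: B. *)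
have K1 : \det K * a ^+ n = \det A * \det (a *: B - c *: (w *m r)).
  have <- : \det (block_mx (1%:M : 'M[R]_m) (v *m r) 0 a%:M) = a ^+ n.
    by rewrite det_ublock det1 mul1r det_scalar.
  rewrite -det_mulmx mulmx_block !mulmx0 !mulmx1 !addr0 mulmxA Av.
  rewrite !mul_mx_scalar -scalemxAl scalerN subrr det_lblock mulNmx.
  congr (_ * \det _); rewrite addrC mulmxA -(mulmxA w) [s *m v]mx11_scalar -/c.
  by rewrite mul_mx_scalar -scalemxAl.
(* Since B *m w = b *: w, the matrix B factors out of b times that update. *)
have K2 : b ^+ n * \det (a *: B - c *: (w *m r))
        = \det B * \det ((a * b)%:M - w *m (c *: r)).
  rewrite -detZ -det_mulmx mulmxBr mul_mx_scalar mulmxA Bw scalerBr !scalerA.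
  by rewrite -scalemxAr -!scalemxAl scalerA [b * a]mulrC [b * c]mulrC.
(* The determinant of a scalar matrix minus a rank-one one, by exchanging the
   column w with the row c *: r. *)
have K3 : (a * b) * \det ((a * b)%:M - w *m (c *: r))
        = (a * b) ^+ n * (a * b - c * (r *m w) 0 0).
  rewrite -[X in X * _ = _]expr1 det_scalar_sub_mulmxC det_mx11.
  by rewrite -scalemxAl !mxE eqxx mulr1n.
apply: (mulIf (expf_neq0 n (mulf_neq0 a0 b0))).
transitivity (\det K * a ^+ n * (b ^+ n * (a * b))).
  by rewrite exprMn; ring.
rewrite K1; transitivity
  (\det A * (a * b) * (b ^+ n * \det (a *: B - c *: (w *m r)))); first by ring.
rewrite K2; transitivity
  (\det A * \det B * ((a * b) * \det ((a * b)%:M - w *m (c *: r)))).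
  by ring.
by rewrite K3; ring.
Qed.

(** det (X - c A) = c^n det (c^-1 X - A). *)
Lemma char_polyZ (F : fieldType) (n : nat) (c : F) (A : 'M[F]_n) : c != 0 ->
  char_poly (c *: A) = c ^+ n *: (char_poly A \Po (c^-1 *: 'X)).
Proof.
move=> c0; rewrite /char_poly -[_ \Po _](det_map_mx (comp_poly _)).
rewrite -mul_polyC polyC_exp -detZ; congr (\det _).
apply/matrixP=> i j; rewrite !mxE raddfB raddfMn /= comp_polyX comp_polyC.
by rewrite mulrBr mulrnAr -polyCM mul_polyC scalerA divff // scale1r.
Qed.

Lemma char_polyZ_prod (F : fieldType) (n : nat) (c : F) (A : 'M[F]_n)
    (s : seq F) : c != 0 ->
  char_poly A = \prod_(x <- s) ('X - x%:P) ->
  char_poly (c *: A) = \prod_(x <- [seq c * x | x <- s]) ('X - x%:P).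
Proof.
move=> c0 As; rewrite char_polyZ // As.
have -> : n = size s.
  have := congr1 (size : {poly F} -> nat) As.
  by rewrite size_char_poly size_prod_XsubC => -[].
rewrite rmorph_prod big_map; elim: s {As} => [|x s IHs].
  by rewrite !big_nil expr0 scale1r.
rewrite !big_cons -{}IHs exprS -scalerA scalerAr scalerAl; congr (_ * _).
rewrite raddfB /= comp_polyX comp_polyC scalerBr scalerA divff // scale1r.
by rewrite -mul_polyC -polyCM.
Qed.

(** The coupling replaces the eigenvalues a and b of the diagonal blocks by
    those of the 2 x 2 matrix by which the block matrix acts on the span of v and w,
    whose characteristic polynomial is the last factor on the right. *)
Lemma char_poly_eigenvector_block (F : fieldType) (m n : nat) (a b : F)
    (A : 'M[F]_m) (B : 'M[F]_n) (v : 'cV[F]_m) (w : 'cV[F]_n)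
    (s : 'rV[F]_m) (r : 'rV[F]_n) :
  A *m v = a *: v -> B *m w = b *: w ->
  char_poly (block_mx A (v *m r) (w *m s) B) * (('X - a%:P) * ('X - b%:P))
    = char_poly A * char_poly B
        * (('X - a%:P) * ('X - b%:P) - ((s *m v) 0 0 * (r *m w) 0 0)%:P).
Proof.
move=> Av Bw; rewrite {1}/char_poly /char_poly_mx map_block_mx !map_mxM.
rewrite scalar_mx_block opp_block_mx add_block_mx !add0r.
have eigenC k c (C : 'M[F]_k) (u : 'cV[F]_k) : C *m u = c *: u ->
    char_poly_mx C *m map_mx polyC u = ('X - c%:P) *: map_mx polyC u.
  by move=> Cu; rewrite mulmxBl -map_mxM Cu map_mxZ mul_scalar_mx scalerBl.
rewrite (@det_eigenvector_block _ _ _ ('X - a%:P) ('X - b%:P)).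
- by rewrite -!map_mxM !mxE polyCM.
- by rewrite polyXsubC_eq0.
- by rewrite polyXsubC_eq0.
- exact: eigenC.
- exact: eigenC.
Qed.

(** * Factorization of the distance matrix of a Cartesian product *)

Lemma sum_enum_val (V : nmodType) (T : finType) (F : T -> V) :
  \sum_(i < #|T|) F (enum_val i) = \sum_x F x.
Proof. by rewrite -big_enum_val; apply: eq_bigl. Qed.

Lemma sum_pred1 (R : pzSemiRingType) (T : finType) (y : T) (F : T -> R) :
  \sum_x (x == y)%:R * F x = F y.
Proof.
rewrite (bigD1 y) //= eqxx mul1r big1 ?addr0 // => x /negPf ->.
exact: mul0r.
Qed.

Section Factorization.
Variables (R : comNzRingType) (G H : digraph).

Definition dist_left : 'M[R]_(#|cart_prod G H|, #|G|) :=
  \matrix_(k, i) (dist (enum_val k).1 (enum_val i))%:R.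
Definition dist_right : 'M[R]_(#|cart_prod G H|, #|H|) :=
  \matrix_(k, j) (dist (enum_val k).2 (enum_val j))%:R.
Definition fiber_left : 'M[R]_(#|G|, #|cart_prod G H|) :=
  \matrix_(i, k) (enum_val i == (enum_val k).1)%:R.
Definition fiber_right : 'M[R]_(#|H|, #|cart_prod G H|) :=
  \matrix_(j, k) (enum_val j == (enum_val k).2)%:R.

(** Multiplying by [fiber_left] on the right spreads the column of a vertex y
    over all the pairs (y, y'), so the first factor only needs one column for
    each vertex of G, and likewise for H. *)
Lemma distance_matrix_cart_prod :
    strongly_connected G -> strongly_connected H ->
  distance_matrix R (cart_prod G H)
    = row_mx dist_left dist_right *m col_mx fiber_left fiber_right.
Proof.
move=> scG scH; rewrite mul_row_col; apply/matrixP=> k l; rewrite !mxE.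
rewrite dist_cart_prod // natrD; congr (_ + _).
  rewrite -(sum_pred1 _ _ (enum_val l).1 (fun x => (dist (enum_val k).1 x)%:R)).
  by rewrite -sum_enum_val; apply: eq_bigr => i _; rewrite !mxE mulrC.
rewrite -(sum_pred1 _ _ (enum_val l).2 (fun x => (dist (enum_val k).2 x)%:R)).
by rewrite -sum_enum_val; apply: eq_bigr => i _; rewrite !mxE mulrC.
Qed.

Lemma sum_cart_left (x : G) (F : G -> H -> R) :
  \sum_(k < #|cart_prod G H|)
     (x == (enum_val k).1)%:R * F (enum_val k).1 (enum_val k).2
    = \sum_y F x y.
Proof.
rewrite (sum_enum_val _ _ (fun p : G * H => (x == p.1)%:R * F p.1 p.2)).
rewrite -(pair_bigA _ (fun a b => (x == a)%:R * F a b)) /=.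
rewrite -(sum_pred1 _ _ x (fun a => \sum_y F a y)).
by apply: eq_bigr => a _; rewrite mulr_sumr eq_sym.
Qed.

Lemma sum_cart_right (y : H) (F : G -> H -> R) :
  \sum_(k < #|cart_prod G H|)
     (y == (enum_val k).2)%:R * F (enum_val k).1 (enum_val k).2
    = \sum_x F x y.
Proof.
rewrite (sum_enum_val _ _ (fun p : G * H => (y == p.2)%:R * F p.1 p.2)).
rewrite -(pair_bigA _ (fun a b => (y == b)%:R * F a b)) /=.
apply: eq_bigr => a _; rewrite -(sum_pred1 _ _ y (F a)).
by apply: eq_bigr => b _; rewrite eq_sym.
Qed.

(** Summing [dist_left] over a fiber of the first projection repeats #|H| times
    the same row of the distance matrix of G; summing [dist_right] over it runs
    once through H, whichever the fiber, whence the rank-one blocks. *)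
Lemma fiber_dist_block :
  col_mx fiber_left fiber_right *m row_mx dist_left dist_right
    = block_mx (#|H|%:R *: distance_matrix R G)
        ((const_mx 1 : 'cV_#|G|)
           *m ((const_mx 1 : 'rV_#|H|) *m distance_matrix R H))
        ((const_mx 1 : 'cV_#|H|)
           *m ((const_mx 1 : 'rV_#|G|) *m distance_matrix R G))
        (#|G|%:R *: distance_matrix R H).
Proof.
rewrite mul_col_row; congr block_mx; apply/matrixP=> i j.
- rewrite !mxE mulr_natl -sumr_const.
  rewrite -(sum_cart_left _ (fun x y => (dist x (enum_val j))%:R)).
  by apply: eq_bigr => k _; rewrite !mxE.
- rewrite !mxE big_ord1 !mxE mul1r.
  under [RHS]eq_bigr do rewrite !mxE mul1r.
  rewrite (sum_enum_val _ _ (fun y => (dist y (enum_val j))%:R)).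
  rewrite -(sum_cart_left (enum_val i) (fun x y => (dist y (enum_val j))%:R)).
  by apply: eq_bigr => k _; rewrite !mxE.
- rewrite !mxE big_ord1 !mxE mul1r.
  under [RHS]eq_bigr do rewrite !mxE mul1r.
  rewrite (sum_enum_val _ _ (fun x => (dist x (enum_val j))%:R)).
  rewrite -(sum_cart_right (enum_val i) (fun x y => (dist x (enum_val j))%:R)).
  by apply: eq_bigr => k _; rewrite !mxE.
rewrite !mxE mulr_natl -sumr_const.
rewrite -(sum_cart_right _ (fun x y => (dist y (enum_val j))%:R)).
by apply: eq_bigr => k _; rewrite !mxE.
Qed.

End Factorization.

(** * Transmission regularity *)

Lemma distance_matrix_const (R : nzSemiRingType) (G : digraph) (t : nat) :
    transmission_regular G t ->
  distance_matrix R G *m const_mx 1 = t%:R *: (const_mx 1 : 'cV_#|G|).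
Proof.
case=> _ tG; apply/matrixP=> i j; rewrite !mxE mulr1 -(tG (enum_val i)).
under eq_bigr do rewrite !mxE mulr1.
by rewrite (sum_enum_val _ _ (fun y => (dist (enum_val i) y)%:R)) natr_sum.
Qed.

Lemma sum_distance_matrix (R : comNzRingType) (G : digraph) (t : nat) :
    transmission_regular G t ->
  ((const_mx 1 : 'rV_#|G|) *m distance_matrix R G *m const_mx 1) 0 (0 : 'I_1)
    = (#|G| * t)%:R.
Proof.
move=> tG; rewrite -mulmxA (distance_matrix_const _ _ _ tG) !mxE.
under eq_bigr do rewrite !mxE mulr1 mul1r.
by rewrite sumr_const card_ord mulnC natrM mulr_natr.
Qed.

(** * The spectrum of the product *)

Theorem theorem2p7 (R : realType) (G G' : digraph) (n n' t t' : nat)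
    (d d' : seq R[i]) :
  #|G| = n -> #|G'| = n' ->
  transmission_regular G t -> transmission_regular G' t' ->
  perm_eq (spec (distance_matrix R[i] G)) (t%:R :: d) ->
  perm_eq (spec (distance_matrix R[i] G')) (t'%:R :: d') ->
  perm_eq (spec (distance_matrix R[i] (cart_prod G G')))
    ((n * t' + n' * t)%:R ::
       [seq n'%:R * x | x <- d] ++ [seq n%:R * x | x <- d'] ++
       nseq ((n - 1) * (n' - 1))%N 0).
Proof.
move=> <- <- tG tG' sG sG' {n n'}.
have [[scG _] [scG' _]] := (tG, tG').
set n := #|G|; set n' := #|G'|.
have [n1 n1'] : (1 < n)%N /\ (1 < n')%N by split; [case: scG | case: scG'].
have natC0 k : (1 < k)%N -> k%:R != 0 :> R[i].
  by move=> k1; rewrite Num.Theory.pnatr_eq0 -lt0n ltnW.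
have cG : char_poly (n'%:R *: distance_matrix R[i] G)
    = ('X - (n' * t)%:R%:P) * \prod_(x <- [seq n'%:R * x | x <- d]) ('X - x%:P).
  rewrite (@char_polyZ_prod _ _ _ _ (t%:R :: d)) ?natC0 //=.
    by rewrite big_cons natrM.
  by rewrite char_poly_spec (perm_big _ sG).
have cG' : char_poly (n%:R *: distance_matrix R[i] G')
    = ('X - (n * t')%:R%:P) * \prod_(x <- [seq n%:R * x | x <- d']) ('X - x%:P).
  rewrite (@char_polyZ_prod _ _ _ _ (t'%:R :: d')) ?natC0 //=.
    by rewrite big_cons natrM.
  by rewrite char_poly_spec (perm_big _ sG').
have eG : (n'%:R *: distance_matrix R[i] G) *m const_mx 1
    = (n' * t)%:R *: (const_mx 1 : 'cV_n).
  by rewrite -scalemxAl (distance_matrix_const _ _ _ tG) scalerA -natrM.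
have eG' : (n%:R *: distance_matrix R[i] G') *m const_mx 1
    = (n * t')%:R *: (const_mx 1 : 'cV_n').
  by rewrite -scalemxAl (distance_matrix_const _ _ _ tG') scalerA -natrM.
have := @char_poly_eigenvector_block _ _ _ _ _ _ _ _ _
  (const_mx 1 *m distance_matrix R[i] G) (const_mx 1 *m distance_matrix R[i] G')
  eG eG'.
rewrite (sum_distance_matrix _ _ _ tG) (sum_distance_matrix _ _ _ tG') cG cG'.
rewrite -fiber_dist_block.
set P := \prod_(x <- _) _; set Q := \prod_(x <- _) _; set N := char_poly _.
set a := 'X - _; set b := 'X - _ => Nab.
(* Here a * b - (n t) (n' t') = X (X - (n t' + n' t)). *)
have {Nab} NE : N = 'X * ('X - (n * t' + n' * t)%:R%:P) * (P * Q).
  have ab0 : a * b != 0 by rewrite mulf_neq0 ?polyXsubC_eq0.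
  apply: (mulIf ab0); rewrite Nab /a /b -/n -/n' !natrD !natrM.
  by rewrite !rmorphD !rmorphM /=; ring.
have := char_poly_mulmxC _ _ _ (row_mx (dist_left _ G G') (dist_right _ G G'))
  (col_mx (fiber_left R[i] G G') (fiber_right _ G G')).
rewrite -distance_matrix_cart_prod // -/N NE.
rewrite [X in _ = 'X^X * _]card_prod -/n -/n' => cM.
apply: prod_XsubC_eq; rewrite -char_poly_spec.
have X0 : 'X^(n + n') != 0 :> {poly R[i]} by rewrite expf_neq0 ?polyX_eq0.
apply: (mulfI X0); rewrite cM big_cons !big_cat /= -/P -/Q.
have -> : \prod_(x <- nseq ((n - 1) * (n' - 1)) 0) ('X - x%:P)
    = 'X^((n - 1) * (n' - 1)) :> {poly R[i]}.
  by rewrite big_nseq subr0 iter_mulr_1.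
transitivity ('X^(n * n' + 1) * ('X - (n * t' + n' * t)%:R%:P) * (P * Q)).
  by rewrite exprD expr1; ring.
(* One zero comes from the 2 x 2 action on span(1, 1') and n n' - (n + n') from
   the exchange of factors, which makes (n - 1) (n' - 1) zeros in all. *)
have -> : (n * n' + 1 = n + n' + (n - 1) * (n' - 1))%N.
  by rewrite -(subnKC (ltnW n1)) -(subnKC (ltnW n1')) !addKn; ring.
by rewrite exprD; ring.
Qed.
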